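(* Let $G\subset AM(\mathcal{A}^* )$ be a finite group containing an antimorphism and let $\mathbf{u}$ be an infinite word whose language is invariant under all elements of $G$. If there exists an integer $N$ such that every factor of $\mathbf{u}$ of length at least $N$ contains all letters of $\mathcal{A}$, then $$\Delta\mathcal{C}(n)+\#G\ \ge\ \sum_{\Theta\in G^{(2)}}\bigl(\mathcal{P}_\Theta(n)+\mathcal{P}_\Theta(n+1)\bigr)\quad\text{for all } n\ge N.$$
   Context: $AM(\mathcal{A}^* )$ is the monoid (under composition) of all morphisms ($\nu(vw)=\nu(v)\nu(w)$) and antimorphisms ($\nu(vw)=\nu(w)\nu(v)$) of $\mathcal{A}^*$, with unit the identity. $G^{(2)}=\{\Theta\in G \mid \Theta \text{ is an antimorphism and } \Theta^2=\mathrm{Id}\}$. The language $\mathcal{L}(\mathbf{u})$ (set of factors) is invariant under $\Theta$ if $\Theta(\mathcal{L}(\mathbf{u}))\subseteq\mathcal{L}(\mathbf{u})$. $\mathcal{C}(n)$ is the number of factors of length $n$, $\Delta\mathcal{C}(n)=\mathcal{C}(n+1)-\mathcal{C}(n)$, and $\mathcal{P}_\Theta(n)$ is the number of factors $w$ of length $n$ with $\Theta(w)=w$. The alphabet $\mathcal{A}$ consists exactly of the letters occurring in $\mathbf{u}$.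
   Formalization: The alphabet is assumed to have at least two letters: on a one-letter alphabet the identity is itself an involutive antimorphism, so G = {Id} and the claim would read 0 + 1 ≥ 2, which is false. *)

(* Defs.v *)
From mathcomp Require Import all_boot all_order all_algebra finmap.
From mathcomp Require Import mathcomp_extra boolp classical_sets functions.
From mathcomp Require Import cardinality fsbigop.

Set Implicit Arguments.
Unset Strict Implicit.
Unset Printing Implicit Defensive.

Import Order.TTheory GRing.Theory Num.Theory.

Local Open Scope classical_set_scope.
Local Open Scope ring_scope.

Section Words.
Variable A : finType.

(* Preservation of the empty word follows from the two identities below. *)
Definition word_morphism (f : seq A -> seq A) : Prop :=
  forall v w, f (v ++ w) = f v ++ f w.

Definition word_antimorphism (f : seq A -> seq A) : Prop :=
  forall v w, f (v ++ w) = f w ++ f v.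

Definition AM : set (seq A -> seq A) :=
  [set f | word_morphism f \/ word_antimorphism f].

Record AM_group (G : set (seq A -> seq A)) : Prop := {
  AM_group_sub : G `<=` AM;
  AM_group_id : G id;
  AM_group_comp : forall f g, G f -> G g -> G (f \o g);
  AM_group_inv : forall f, G f ->
    exists g, [/\ G g, f \o g = id & g \o f = id]
}.

Definition involutive_antimorphisms (G : set (seq A -> seq A)) :
    set (seq A -> seq A) :=
  [set Theta | [/\ G Theta, word_antimorphism Theta & Theta \o Theta = id]].

Definition language (u : nat -> A) : set (seq A) :=
  [set w | exists i n, w = [seq u k | k <- iota i n]].

Definition invariant_under (L : set (seq A)) (Theta : seq A -> seq A) : Prop :=
  Theta @` L `<=` L.

Definition complexity (u : nat -> A) (n : nat) : nat :=
  #|[pred w : n.-tuple A | tval w \in language u]|.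

Definition delta_complexity (u : nat -> A) (n : nat) : int :=
  (complexity u n.+1)%:Z - (complexity u n)%:Z.

Definition pal_complexity (u : nat -> A) (Theta : seq A -> seq A) (n : nat) :
    nat :=
  #|[pred w : n.-tuple A |
      (tval w \in language u) && (Theta (tval w) == tval w)]|.

End Words.

(* Main.v *)
Require Import Defs.
From HB Require Import structures.
From mathcomp Require Import all_boot all_order all_algebra all_fingroup finmap.
From mathcomp Require Import mathcomp_extra boolp classical_sets functions.
From mathcomp Require Import cardinality fsbigop.
From mathcomp Require Import zify.

Set Implicit Arguments.
Unset Strict Implicit.
Unset Printing Implicit Defensive.

Import Order.TTheory GRing.Theory Num.Theory.

(** In the Rauzy graph, whose vertices and edges are the factors of length [n]
    and [n + 1], call an edge crossing if its endpoints lie in distinct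
    [G]-orbits.  An element of [G] is determined by its kind and its value on a
    word containing all letters, and an antimorphism fixing an edge exchanges
    its endpoints.  So crossing edges have trivial stabilizers, and every other
    edge is fixed by at most one antimorphism.  Let [r] be the number of orbits
    of vertices.  Reading [u] visits all of them, so crossing edges join at
    least [r - 1] distinct pairs of orbits: [#G (r - 1) + sum P(n+1) <= C(n+1)].
    Burnside's lemma gives [C(n) + sum P(n) <= #G r]. *)

(* A vertex other than [c 0] is sent to the pair through which the walk first
   reaches it. *)
Lemma leq_card_walk (T : finType) (c : nat -> T) (V : {set T})
    (E : {set {set T}}) :
  {in V, forall v, exists i, c i = v} ->
  (forall i, c i != c i.+1 -> [set c i; c i.+1] \in E) ->
  #|V| <= #|E|.+1.
Proof.
move=> Vc cE.
have /fin_all_exists[t tP] v : exists i,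
    v \in V -> c i = v /\ forall j, c j = v -> i <= j.
  case: (boolP (v \in V)) => [/Vc cv|_]; last by exists 0.
  have exv : exists i, c i == v by case: cv => i <-; exists i.
  case: (ex_minnP exv) => i /eqP civ mini; exists i => _; split=> // j cjv.
  by apply: mini; apply/eqP.
have first_step v : v \in V :\ c 0 ->
    exists i, [/\ t v = i.+1, c i.+1 = v & forall j, c j = v -> i < j].
  rewrite !inE => /andP[v_neq /tP[ctv mint]].
  case tv: (t v) ctv mint v_neq => [|i] ctv mint; last by exists i.
  by rewrite ctv eqxx.
pose entry v := [set c (t v).-1; c (t v)].
have entry_inj : {in V :\ c 0 &, injective entry}.
  move=> v w /first_step[i [tv civ mini]] /first_step[j [tw cjw minj]].
  rewrite /entry tv tw /= => Eij.
  suff ij : i = j by rewrite -civ -cjw ij.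
  have : v \in [set c j; c j.+1] by rewrite -Eij civ !inE eqxx orbT.
  have : w \in [set c i; c i.+1] by rewrite Eij cjw !inE eqxx orbT.
  rewrite !inE => /orP[] /eqP/esym/minj lt_ji /orP[] /eqP/esym/mini lt_ij; lia.
rewrite (cardsD1 (c 0)) -add1n leq_add ?leq_b1 // -(card_in_imset entry_inj).
apply/subset_leq_card/fintype.subsetP => _ /imsetP[v + ->].
move=> /first_step[i [tv civ mini]]; rewrite /entry tv; apply: cE.
by apply/eqP => cij; have := mini i; rewrite cij civ ltnn => /(_ erefl).
Qed.

Section ActionCounting.
Local Open Scope group_scope.
Variables (aT : finGroupType) (D : {group aT}) (rT : finType).
Variables (to : action D rT) (G : {group aT}) (S : {set rT}).
Hypothesis GactS : [acts G, on S | to].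

Lemma leq_card_free_action (T : finType) (f : rT -> T) :
  {in S, forall x, 'C_G[x | to] = 1} ->
  {in S & G, forall x a, f (to x a) = f x} ->
  (#|f @: S| * #|G| <= #|S|)%N.
Proof.
move=> stab1 f_inv; rewrite -[leqRHS]sum1_card (partition_big_imset f) /=.
rewrite -sum_nat_const; apply: leq_sum => _ /imsetP[x Sx ->].
rewrite -(card_orbit_in_stab to x (acts_dom GactS)) stab1 // cards1 muln1.
rewrite sum1dep_card; apply/subset_leq_card/fintype.subsetP.
move=> _ /orbitP[a Ga <-].
by rewrite !inE (acts_act GactS) // Sx f_inv /=.
Qed.

Lemma sum_card_Fix (I : {set aT}) : I \subset D ->
  \sum_(a in I) #|'Fix_(S | to)[a]| = \sum_(x in S) #|'C_I[x | to]|.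
Proof.
move=> sID; under eq_bigr => a _ do rewrite -sum1_card.
rewrite (exchange_big_dep [in S]) /= => [|a x _]; last by case/finset.setIP.
apply: eq_bigr => x Sx; rewrite -sum1_card; apply: eq_bigl => a.
rewrite !(finset.sub1set, finset.inE) Sx.
by case: (boolP (a \in I)) => // /(fintype.subsetP sID) ->.
Qed.

Lemma leq_card_add_sum_Fix (I : {set aT}) : I \subset G -> 1 \notin I ->
  (#|S| + \sum_(a in I) #|'Fix_(S | to)[a]| <= #|orbit to G @: S| * #|G|)%N.
Proof.
move=> sIG I'1; rewrite -(Frobenius_Cauchy GactS).
rewrite [leqRHS](big_setD1 1) ?group1 //=; apply: leq_add.
  apply/subset_leq_card/fintype.subsetP => x Sx.
  by rewrite inE Sx; apply/afix1P; rewrite act1.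
have /finset.setIidPr sIG1 : I \subset G^# by rewrite subsetD1 sIG.
by rewrite [leqRHS](big_setID I) /= sIG1 leq_addr.
Qed.

End ActionCounting.

Section WordMaps.
Variable A : finType.
Implicit Types (f g : seq A -> seq A) (v w : seq A).

Lemma AM_nil f : AM f -> f [::] = [::].
Proof.
move=> [] /(_ [::] [::]) /= /(congr1 size); rewrite size_cat;
  by case: (f [::]) => //= x s; lia.
Qed.

Lemma AM_size_ge f w : AM f -> injective f -> size w <= size (f w).
Proof.
move=> AMf injf; elim: w => [//|a w IHw].
have fa_gt0 : 0 < size (f [:: a]).
  rewrite lt0n size_eq0; apply/eqP => fa0.
  by have := injf [:: a] [::]; rewrite (AM_nil AMf) fa0 => /(_ erefl).
by rewrite -cat1s; case: AMf => ->; rewrite !size_cat /=; lia.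
Qed.

Lemma AM_size f g w : AM f -> AM g -> cancel f g -> cancel g f ->
  size (f w) = size w.
Proof.
move=> AMf AMg fK gK; apply/eqP; rewrite eqn_leq; apply/andP; split.
  by rewrite -[in leqRHS](fK w) AM_size_ge //; exact: can_inj gK.
by rewrite AM_size_ge //; exact: can_inj fK.
Qed.

Lemma word_antimorphism_neq_id f : 1 < #|A| -> word_antimorphism f ->
  f <> id.
Proof.
move=> /card_gt1P[a [b [_ _ ab]]] anti fid.
by have := anti [:: a] [:: b]; rewrite fid /= => -[/eqP]; rewrite (negPf ab).
Qed.

Lemma word_morphism_ext f g w :
  (forall v, size (f v) = size v) -> (forall v, size (g v) = size v) ->
  word_morphism f -> word_morphism g ->
  f w = g w -> (forall a, a \in w) -> f = g.
Proof.
move=> szf szg morf morg fgw allw.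
have eq_letter : forall a, a \in w -> f [:: a] = g [:: a].
  elim: w fgw {allw} => [//|b w IHw] /eqP.
  rewrite -cat1s morf morg eqseq_cat ?szf ?szg // => /andP[/eqP fb /eqP fw] a.
  by rewrite inE => /orP[/eqP ->|/IHw ->].
apply/funext; elim => [|a v IHv]; first by rewrite !AM_nil //; left.
by rewrite -cat1s morf morg IHv eq_letter.
Qed.

Lemma word_antimorphism_ext f g w :
  (forall v, size (f v) = size v) -> (forall v, size (g v) = size v) ->
  word_antimorphism f -> word_antimorphism g ->
  f w = g w -> (forall a, a \in w) -> f = g.
Proof.
move=> szf szg antf antg fgw allw.
have rev_ext : rev \o f = rev \o g.
  apply: (word_morphism_ext _ _ _ _ _ allw) => [v|v|v v'|v v'|] /=.
  - by rewrite size_rev.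
  - by rewrite size_rev.
  - by rewrite antf rev_cat.
  - by rewrite antg rev_cat.
  - by rewrite fgw.
by apply/funext => v; apply: (can_inj revK); exact: (congr1 (@^~ v) rev_ext).
Qed.

Section TakeDrop.
Variables (f : seq A -> seq A) (k : nat) (w : seq A).
Hypothesis size_f : forall v, size (f v) = size v.

Lemma word_antimorphism_take :
  word_antimorphism f -> f (take k w) = drop (size w - k) (f w).
Proof.
move=> antf; rewrite -[in f w](cat_take_drop k w) antf drop_size_cat //.
by rewrite size_f size_drop.
Qed.

Lemma word_antimorphism_drop :
  word_antimorphism f -> f (drop k w) = take (size w - k) (f w).
Proof.
move=> antf; rewrite -[in f w](cat_take_drop k w) antf take_size_cat //.
by rewrite size_f size_drop.
Qed.

Hypothesis le_kw : k <= size w.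

Lemma word_morphism_take : word_morphism f -> f (take k w) = take k (f w).
Proof.
move=> morf; rewrite -[in RHS](cat_take_drop k w) morf take_size_cat //.
by rewrite size_f size_takel.
Qed.

Lemma word_morphism_drop : word_morphism f -> f (drop k w) = drop k (f w).
Proof.
move=> morf; rewrite -[in RHS](cat_take_drop k w) morf drop_size_cat //.
by rewrite size_f size_takel.
Qed.

End TakeDrop.
End WordMaps.

Section AMFinGroup.
Variables (A : finType) (G : set (seq A -> seq A)).
Hypotheses (GG : AM_group G) (finG : finite_set G).

Definition AM_finGroup & AM_group G & finite_set G : predArgType :=
  fset_set G.

Local Notation gT := (AM_finGroup GG finG).
HB.instance Definition _ := Finite.on gT.

Definition AM_fun (g : gT) : seq A -> seq A := fsval g.

Lemma AM_fun_inj : injective AM_fun.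
Proof. exact: val_inj. Qed.

Lemma AM_funP (g : gT) : G (AM_fun g).
Proof. by have := fsvalP g; rewrite in_fset_set // inE. Qed.

Lemma card_AM_finGroup : #|gT| = #|` fset_set G|%fset.
Proof. by rewrite cardfE. Qed.

Lemma AM_fun_surj f : G f -> exists g, AM_fun g = f.
Proof.
move=> Gf; have fF : f \in fset_set G by rewrite in_fset_set // inE.
by exists [` fF]%fset.
Qed.

(* Composition is flipped because actions in [action.v] are right actions. *)
Definition AM_mul (g h : gT) : gT :=
  sval (cid (AM_fun_surj (AM_group_comp GG (AM_funP h) (AM_funP g)))).

Definition AM_one : gT := sval (cid (AM_fun_surj (AM_group_id GG))).

Lemma AM_funM g h : AM_fun (AM_mul g h) = AM_fun h \o AM_fun g.
Proof. by rewrite /AM_mul; case: cid. Qed.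

Lemma AM_fun1 : AM_fun AM_one = id.
Proof. by rewrite /AM_one; case: cid. Qed.

Lemma AM_inverse_exists (g : gT) : exists h : gT, AM_mul h g = AM_one.
Proof.
have [f [Gf gf _]] := AM_group_inv GG (AM_funP g).
have [h hE] := AM_fun_surj Gf; exists h.
by apply: AM_fun_inj; rewrite AM_funM AM_fun1 hE.
Qed.

Definition AM_inv (g : gT) : gT := sval (cid (AM_inverse_exists g)).

Lemma AM_mulA : associative AM_mul.
Proof. by move=> f g h; apply: AM_fun_inj; rewrite !AM_funM. Qed.

Lemma AM_mul1g : left_id AM_one AM_mul.
Proof. by move=> g; apply: AM_fun_inj; rewrite AM_funM AM_fun1. Qed.

Lemma AM_mulVg : left_inverse AM_one AM_inv AM_mul.
Proof. by move=> g; rewrite /AM_inv; case: cid. Qed.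

HB.instance Definition _ := Finite_isGroup.Build gT AM_mulA AM_mul1g AM_mulVg.

End AMFinGroup.

Section WordAction.
Variables (A : finType) (G : set (seq A -> seq A)).
Variables (GG : AM_group G) (finG : finite_set G).

Local Notation gT := (AM_finGroup GG finG).

Lemma size_AM_fun (g : gT) w : size (AM_fun g w) = size w.
Proof.
have [f [Gf gf fg]] := AM_group_inv GG (AM_funP g).
apply: (@AM_size _ _ f); first exact: AM_group_sub GG _ (AM_funP g).
- exact: AM_group_sub GG _ Gf.
- by move=> v; exact: (congr1 (@^~ v) fg).
- by move=> v; exact: (congr1 (@^~ v) gf).
Qed.

#[local] Hint Resolve size_AM_fun : core.

Lemma size_AM_fun_tuple n (w : n.-tuple A) (g : gT) : size (AM_fun g w) == n.
Proof. by rewrite size_AM_fun size_tuple. Qed.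

Definition word_act n (w : n.-tuple A) (g : gT) : n.-tuple A :=
  Tuple (size_AM_fun_tuple w g).

Lemma val_word_act n (w : n.-tuple A) g : val (word_act w g) = AM_fun g w.
Proof. by []. Qed.

Lemma word_act1 n : (@word_act n)^~ 1%g =1 id.
Proof. by move=> w; apply: val_inj; rewrite /= AM_fun1. Qed.

Lemma word_actM n (w : n.-tuple A) : act_morph (@word_act n) w.
Proof. by move=> g h; apply: val_inj; rewrite /= AM_funM. Qed.

Canonical word_action n := TotalAction (@word_act1 n) (@word_actM n).

Local Notation orbit_of := (orbit (word_action _) [set: gT]).

Lemma AM_fun_eq_id (g : gT) : AM_fun g = id -> g = 1%g.
Proof. by move=> gid; apply: AM_fun_inj; rewrite gid AM_fun1. Qed.

Lemma AM_fun_kind (g : gT) :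
  word_morphism (AM_fun g) \/ word_antimorphism (AM_fun g).
Proof. exact: AM_group_sub GG _ (AM_funP g). Qed.

Definition antimorphic_involutions : {set gT} :=
  [set g : gT | AM_fun g \in involutive_antimorphisms G]%SET.

Lemma one_notin_antimorphic_involutions : 1 < #|A| ->
  1%g \notin antimorphic_involutions.
Proof.
move=> A_gt1; rewrite inE; apply/negP => /set_mem[_ anti _].
by apply: (word_antimorphism_neq_id A_gt1 anti); rewrite AM_fun1.
Qed.

Lemma sum_involutive_antimorphisms (V : nmodType) (F : (seq A -> seq A) -> V) :
  (\sum_(f \in involutive_antimorphisms G) F f =
   \sum_(g in antimorphic_involutions) F (AM_fun g))%R.
Proof.
have /setIidr sIG : (involutive_antimorphisms G `<=` G)%classic by move=> f [].
rewrite -[in LHS]sIG fsbig_mkcondr fsbig_finite // big_seq_fsetE -big_mkcond.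
by apply: eq_bigl => g; rewrite finset.inE.
Qed.

Section Endpoints.
Variable n : nat.
Implicit Type e : n.+1.-tuple A.

Definition edge_source e : n.-tuple A :=
  belast_tuple (thead e) (behead_tuple e).

Definition edge_target e : n.-tuple A := behead_tuple e.

Lemma val_edge_source e : val (edge_source e) = take n e.
Proof.
rewrite [in RHS](tuple_eta e) [in RHS]/= lastI -cats1 take_size_cat //.
by rewrite size_belast size_tuple.
Qed.

Lemma val_edge_target e : val (edge_target e) = drop 1 e.
Proof. by rewrite drop1. Qed.

Lemma edge_source_act_morphism e (g : gT) : word_morphism (AM_fun g) ->
  edge_source (word_act e g) = word_act (edge_source e) g.
Proof.
move=> morg; apply: val_inj; rewrite val_word_act !val_edge_source.
by apply/esym/word_morphism_take; rewrite ?size_tuple.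
Qed.

Lemma edge_target_act_morphism e (g : gT) : word_morphism (AM_fun g) ->
  edge_target (word_act e g) = word_act (edge_target e) g.
Proof.
move=> morg; apply: val_inj; rewrite val_word_act !val_edge_target.
by apply/esym/word_morphism_drop; rewrite ?size_tuple.
Qed.

Lemma edge_source_act_antimorphism e (g : gT) : word_antimorphism (AM_fun g) ->
  edge_source (word_act e g) = word_act (edge_target e) g.
Proof.
move=> antg; apply: val_inj.
rewrite val_word_act val_edge_source val_edge_target.
by rewrite word_antimorphism_drop // size_tuple subSS subn0.
Qed.

Lemma edge_target_act_antimorphism e (g : gT) : word_antimorphism (AM_fun g) ->
  edge_target (word_act e g) = word_act (edge_source e) g.
Proof.
move=> antg; apply: val_inj.
rewrite val_word_act val_edge_target val_edge_source.
by rewrite word_antimorphism_take // size_tuple subSnn.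
Qed.

Definition edge_orbits e : {set {set n.-tuple A}} :=
  [set orbit_of (edge_source e); orbit_of (edge_target e)]%SET.

Lemma edge_orbits_act e (g : gT) : edge_orbits (word_act e g) = edge_orbits e.
Proof.
rewrite /edge_orbits; case: (AM_fun_kind g) => [morg|antg].
  rewrite edge_source_act_morphism ?edge_target_act_morphism //.
  by rewrite !(orbit_act (word_action n)) ?finset.in_setT.
rewrite edge_source_act_antimorphism ?edge_target_act_antimorphism //.
by rewrite !(orbit_act (word_action n)) ?finset.in_setT // finset.setUC.
Qed.

Definition crossing e : bool :=
  orbit_of (edge_source e) != orbit_of (edge_target e).

Lemma crossingE e : crossing e = (#|edge_orbits e| == 2).
Proof. by rewrite cards2 eqSS eqb1. Qed.

Lemma crossing_act e (g : gT) : crossing (word_act e g) = crossing e.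
Proof. by rewrite !crossingE edge_orbits_act. Qed.

Lemma crossing_fixed_eq1 e (g : gT) : (forall a, a \in tval e) -> crossing e ->
  word_act e g = e -> g = 1%g.
Proof.
move=> full_e cross eg; case: (AM_fun_kind g) => [morg|antg].
  apply/AM_fun_eq_id/(word_morphism_ext _ _ morg _ _ full_e) => //.
  exact: (congr1 val eg).
case/negP: cross; rewrite -{1}eg edge_source_act_antimorphism //.
by rewrite (orbit_act (word_action n)) ?finset.in_setT.
Qed.

End Endpoints.

Section Factors.
Variable u : nat -> A.

Definition factors n : {set n.-tuple A} :=
  [set w : n.-tuple A | tval w \in language u]%SET.

Definition factor_at n i : n.-tuple A := map_tuple u (iota_tuple n i).

Lemma factorsP n (w : n.-tuple A) :
  reflect (exists i, factor_at n i = w) (w \in factors n).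
Proof.
rewrite inE; apply: (iffP idP) => [/set_mem[i [m wE]]|[i <-]].
  have mn : m = n by rewrite -(size_tuple w) wE size_map size_iota.
  by exists i; apply: val_inj; rewrite /= wE mn.
by apply/mem_set; exists i, n.
Qed.

Lemma complexityE n : complexity u n = #|factors n|.
Proof. by rewrite cardsE. Qed.

Lemma pal_complexityE n (g : gT) :
  pal_complexity u (AM_fun g) n = #|'Fix_(factors n | word_action n)[g]%g|.
Proof.
apply: eq_card => w; rewrite finset.in_setI [in RHS]finset.in_set.
by congr (_ && _); rewrite -[LHS]/(word_act w g == w); apply/eqP/afix1P.
Qed.

Lemma edge_source_factor_at n i :
  edge_source (factor_at n.+1 i) = factor_at n i.
Proof.
apply: val_inj; rewrite val_edge_source -[LHS]/(take n (map u (iota i n.+1))).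
by rewrite -map_take take_iota (minn_idPl (leqnSn n)).
Qed.

Lemma edge_target_factor_at n i :
  edge_target (factor_at n.+1 i) = factor_at n i.+1.
Proof. exact: val_inj. Qed.

Hypothesis invG : forall f, G f -> invariant_under (language u) f.

Lemma acts_on_factors n :
  [acts [set: gT], on factors n | word_action n]%g.
Proof.
apply/fintype.subsetP => g _; rewrite !inE; apply/fintype.subsetP => w.
by rewrite !inE => Lw; apply: (invG (AM_funP g)); exists (tval w).
Qed.

Definition factor_orbits n : {set {set n.-tuple A}} :=
  [set orbit_of w | w in factors n]%SET.

Hypothesis A_gt1 : 1 < #|A|.

Lemma complexity_add_pal_le n :
  complexity u n +
    \sum_(g in antimorphic_involutions) pal_complexity u (AM_fun g) n <=
  #|factor_orbits n| * #|gT|.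
Proof.
under eq_bigr do rewrite pal_complexityE.
rewrite complexityE -cardsT.
apply: leq_card_add_sum_Fix (acts_on_factors n) _ _ _.
  exact: finset.subsetT.
exact: one_notin_antimorphic_involutions A_gt1.
Qed.

Definition crossing_edges n : {set n.+1.-tuple A} :=
  (factors n.+1 :&: [set e | crossing e])%SET.

Lemma acts_on_crossing_edges n :
  [acts [set: gT], on crossing_edges n | word_action n.+1]%g.
Proof.
apply/fintype.subsetP => g _; rewrite !inE; apply/fintype.subsetP => e.
move=> /finset.setIP[factor_e cross]; rewrite inE; apply/finset.setIP; split.
  by rewrite (acts_act (acts_on_factors n.+1) (finset.in_setT g)).
by move: cross; rewrite !inE crossing_act.
Qed.

Definition linked_orbits n : {set {set {set n.-tuple A}}} :=
  [set edge_orbits e | e in crossing_edges n]%SET.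

Lemma leq_card_linked_orbits n :
  #|factor_orbits n| <= #|linked_orbits n|.+1.
Proof.
apply: (leq_card_walk (c := fun i => orbit_of (factor_at n i))).
  by move=> _ /imsetP[w /factorsP[i <-] ->]; exists i.
move=> i crossi; apply/imsetP; exists (factor_at n.+1 i); last first.
  by rewrite /edge_orbits edge_source_factor_at edge_target_factor_at.
apply/finset.setIP; split; first by apply/factorsP; exists i.
by rewrite inE /crossing edge_source_factor_at edge_target_factor_at.
Qed.

Section FullLength.
Variable n : nat.
Hypothesis full : forall w, language u w -> n <= size w -> forall a, a \in w.

Lemma full_edge e : e \in factors n.+1 -> forall a, a \in tval e.
Proof. by rewrite inE => /set_mem /full; rewrite size_tuple; apply. Qed.

Lemma leq_card_linked_crossing :
  #|linked_orbits n| * #|gT| <= #|crossing_edges n|.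
Proof.
rewrite -cardsT; apply: (leq_card_free_action (acts_on_crossing_edges n)).
  move=> e /finset.setIP[/full_edge full_e]; rewrite inE => cross.
  apply/trivgP/fintype.subsetP => g /finset.setIP[_ /astab1P eg].
  by apply/finset.set1P; exact: crossing_fixed_eq1 full_e cross eg.
by move=> e g _ _; apply: edge_orbits_act.
Qed.

Lemma card_stab_antimorphic_involutions e : e \in factors n.+1 ->
  #|'C_antimorphic_involutions[e | word_action n.+1]%g| <= ~~ crossing e.
Proof.
move=> /full_edge full_e; case: (boolP (crossing e)) => [cross|_].
  rewrite leqn0 cards_eq0; apply/eqP/setP => g; rewrite finset.in_set0.
  apply/negP => /finset.setIP[gI /astab1P/(crossing_fixed_eq1 full_e cross) g1].
  by move: gI; rewrite g1 (negPf (one_notin_antimorphic_involutions A_gt1)).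
apply/card_le1_eqP => g h.
move=> /finset.setIP[+ /astab1P eg] /finset.setIP[+ /astab1P eh].
rewrite !inE => -[_ antg _] [_ anth _].
apply/esym/AM_fun_inj/(word_antimorphism_ext _ _ antg anth _ full_e) => //.
by rewrite -!val_word_act eg eh.
Qed.

Lemma card_crossing_add_pal_le :
  #|crossing_edges n| +
    \sum_(g in antimorphic_involutions) pal_complexity u (AM_fun g) n.+1 <=
  complexity u n.+1.
Proof.
under eq_bigr do rewrite pal_complexityE.
rewrite complexityE sum_card_Fix ?finset.subsetT //.
rewrite -[leqRHS](cardsID [set e | crossing e]%SET) leq_add2l.
rewrite (big_setID [set e | crossing e]%SET) /= big1 => [|e]; last first.
  move=> /finset.setIP[/card_stab_antimorphic_involutions + cross].
  by rewrite inE in cross; rewrite cross leqn0 => /eqP.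
rewrite add0n -sum1_card; apply: leq_sum => e /finset.setDP[factor_e _].
exact: leq_trans (card_stab_antimorphic_involutions factor_e) (leq_b1 _).
Qed.

Lemma factor_orbits_add_pal_le :
  #|factor_orbits n| * #|gT| +
    \sum_(g in antimorphic_involutions) pal_complexity u (AM_fun g) n.+1 <=
  complexity u n.+1 + #|gT|.
Proof.
have orbits_le : #|factor_orbits n| * #|gT| <= #|crossing_edges n| + #|gT|.
  apply: leq_trans (leq_mul (leq_card_linked_orbits n) (leqnn _)) _.
  by rewrite mulSn addnC leq_add2r leq_card_linked_crossing.
by have := card_crossing_add_pal_le; lia.
Qed.

End FullLength.
End Factors.

End WordAction.

Local Open Scope classical_set_scope.
Local Open Scope ring_scope.

Theorem theorem4 (A : finType) (u : nat -> A) (G : set (seq A -> seq A))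
    (N : nat) :
  (1 < #|A|)%N ->
  range u = setT ->
  AM_group G ->
  finite_set G ->
  (exists2 Theta, G Theta & word_antimorphism Theta) ->
  (forall Theta, G Theta -> invariant_under (language u) Theta) ->
  (forall w, language u w -> (N <= size w)%N -> forall a : A, a \in w) ->
  forall n : nat, (N <= n)%N ->
    \sum_(Theta \in involutive_antimorphisms G)
      ((pal_complexity u Theta n)%:Z + (pal_complexity u Theta n.+1)%:Z)
    <= delta_complexity u n + (#|` fset_set G|)%:Z.
Proof.
move=> A_gt1 _ GG finG _ invG fullN n le_Nn.
have full w : language u w -> (n <= size w)%N -> forall a, a \in w.
  by move=> Lw le_nw; apply: fullN (leq_trans le_Nn le_nw).
have := complexity_add_pal_le GG finG invG A_gt1 n.
have := factor_orbits_add_pal_le GG finG invG A_gt1 full.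
rewrite (sum_involutive_antimorphisms GG finG) big_split /=.
rewrite -!(big_morph Posz PoszD erefl) /delta_complexity.
by rewrite -(card_AM_finGroup GG finG); lia.
Qed.
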